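(* Among the seven-qubit states $$|\psi\rangle_7=\alpha_1|0000000\rangle+\alpha_2|0001111\rangle+\alpha_3|1111000\rangle+\alpha_4|1110111\rangle$$ with $\alpha_1,\dots,\alpha_4\in\mathbb{R}$ and $\alpha_1^2=\alpha_2^2=\alpha_3^2=\alpha_4^2=\tfrac14$, there is one that is a ground state (an eigenvector for the lowest eigenvalue) of the seven-qubit toric code Hamiltonian on a disk $$H_{7td}=-\sum_{i=1}^{6}A_i-\sum_{j=1}^{2}B_j .$$
   Context: Number the seven qubits $1,\dots,7$ from left to right, and let $Z_k$ (resp. $X_k$) denote the operator on $(\mathbb{C}^2)^{\otimes 7}$ acting as the Pauli matrix $\sigma_z$ (resp. $\sigma_x$) on qubit $k$ and as the identity on the others; $\sigma_z|0\rangle=|0\rangle$, $\sigma_z|1\rangle=-|1\rangle$, $\sigma_x|0\rangle=|1\rangle$, $\sigma_x|1\rangle=|0\rangle$. Then $A_1=Z_1Z_2$, $A_2=Z_1Z_3$, $A_3=Z_2Z_4Z_5$, $A_4=Z_3Z_4Z_6$, $A_5=Z_5Z_7$, $A_6=Z_6Z_7$, $B_1=X_1X_2X_3X_4$, $B_2=X_4X_5X_6X_7$. *)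

(* Defs.v *)
From HB Require Import structures.
From mathcomp Require Import all_boot all_order all_algebra.
From mathcomp Require Import reals.
From mathcomp Require Import complex mxtens.

Set Implicit Arguments.
Unset Strict Implicit.
Unset Printing Implicit Defensive.

Import Order.TTheory GRing.Theory Num.Theory.
Local Open Scope ring_scope.
Local Open Scope complex_scope.

(* f 0 *t f 1 *t ... *t f n, bracketed to the right.  The types agree because
   p ^ n.+2 is convertible to p * p ^ n.+1. *)
Fixpoint tensor (C : pzRingType) (p q n : nat) :
    ('I_n.+1 -> 'M[C]_(p, q)) -> 'M[C]_(p ^ n.+1, q ^ n.+1) :=
  match n with
  | 0 => fun f => f ord0
  | m.+1 => fun f => f ord0 *t tensor (fun i : 'I_m.+1 => f (lift ord0 i))
  end.

Section Qubits.
Variable R : realType.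

Definition sigma_z : 'M[R[i]]_2 :=
  \matrix_(i, j) (if i == j then (-1) ^+ i else 0).

Definition sigma_x : 'M[R[i]]_2 := \matrix_(i, j) (i != j)%:R.

(* The computational basis vector |s_1 ... s_7> of (C^2)^{\otimes 7}; the cast
   only identifies 1 ^ 7 columns with a single one. *)
Definition ket (s : 7.-tuple 'I_2) : 'cV[R[i]]_(2 ^ 7) :=
  castmx (erefl, exp1n 7)
    (tensor (fun k : 'I_7 => delta_mx (tnth s k) 0 : 'cV[R[i]]_2)).

(* P on qubit k, the identity elsewhere; qubits are numbered from 1, whereas
   the elements of 'I_7 start at 0. *)
Definition on_qubit (P : 'M[R[i]]_2) (k : nat) : 'M[R[i]]_(2 ^ 7) :=
  tensor (fun i : 'I_7 => if i.+1 == k then P else 1%:M).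

Definition Z (k : nat) := on_qubit sigma_z k.
Definition X (k : nat) := on_qubit sigma_x k.

Definition A1 := Z 1 *m Z 2.
Definition A2 := Z 1 *m Z 3.
Definition A3 := Z 2 *m Z 4 *m Z 5.
Definition A4 := Z 3 *m Z 4 *m Z 6.
Definition A5 := Z 5 *m Z 7.
Definition A6 := Z 6 *m Z 7.
Definition B1 := X 1 *m X 2 *m X 3 *m X 4.
Definition B2 := X 4 *m X 5 *m X 6 *m X 7.

Definition H7td : 'M[R[i]]_(2 ^ 7) :=
  - (A1 + A2 + A3 + A4 + A5 + A6) - (B1 + B2).

Definition psi7 (a1 a2 a3 a4 : R) : 'cV[R[i]]_(2 ^ 7) :=
    a1%:C *: ket [tuple 0; 0; 0; 0; 0; 0; 0]
  + a2%:C *: ket [tuple 0; 0; 0; 1; 1; 1; 1]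
  + a3%:C *: ket [tuple 1; 1; 1; 1; 0; 0; 0]
  + a4%:C *: ket [tuple 1; 1; 1; 0; 1; 1; 1].

(* Operators act on column vectors, whereas the library's eigenvalue and
   eigenspace refer to row vectors. *)
Definition eigenvector n (H : 'M[R[i]]_n) (E : R[i]) (v : 'cV[R[i]]_n) : Prop :=
  v != 0 /\ H *m v = E *: v.

(* E <= E' in R[i] means that E and E' have the same imaginary part and that
   their real parts are so ordered.  A Hermitian H has only real eigenvalues,
   on which this is the usual order. *)
Definition ground_state n (H : 'M[R[i]]_n) (v : 'cV[R[i]]_n) : Prop :=
  exists2 E : R[i], eigenvector H E v &
    forall (E' : R[i]) (w : 'cV[R[i]]_n), eigenvector H E' w -> E <= E'.

End Qubits.

(* Main.v *)
Require Import Defs.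
From HB Require Import structures.
From mathcomp Require Import all_boot all_order all_algebra.
From mathcomp Require Import reals.
From mathcomp Require Import complex mxtens ring.

Set Implicit Arguments.
Unset Strict Implicit.

Import Order.TTheory GRing.Theory Num.Theory.

Local Open Scope ring_scope.

(** The [A_i] and [B_j] are commuting involutions.  Hence, if [E] is an
    eigenvalue of [H7td] with eigenvector [w], then for each of these eight
    operators [S] one of the vectors [w + S w], [w - S w] is again a nonzero
    eigenvector for [E], and it is an eigenvector of [S] for the eigenvalue
    [1] or [-1].  Doing this for all eight operators gives a joint eigenvector,
    so [E] is a sum of eight signs and [E >= -8].  The value [-8] is attained
    at the uniform superposition ([alpha_i = 1/2]): every [A_i] fixes each of
    its four kets, while every [B_j] permutes them. *)

(** * Eigenvalue bound for a sum of commuting involutions *)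

Section InvolutionSums.
Variables (F : numFieldType) (n : nat).
Implicit Types (S : 'M[F]_n) (Ss : seq 'M[F]_n) (w : 'cV[F]_n).

Definition commuting_involutions Ss :=
  {in Ss, forall S, S *m S = 1%:M} /\ {in Ss &, forall S T, S *m T = T *m S}.

(** The two candidates [w + S w] and [w - S w] add up to [2 w], which is nonzero in characteristic
    0, so they cannot both vanish. *)
Lemma involution_eigenvector S w : S *m S = 1%:M -> w != 0 ->
  exists2 s : F, s = 1 \/ s = -1 & w + s *: (S *m w) != 0.
Proof.
move=> SS w0; have [w1|w1] := eqVneq (w + 1 *: (S *m w)) 0; last first.
  by exists 1 => //; left.
exists (-1); first by right.
apply: contra_neq w0 => w2; rewrite -[w](@scalerK _ _ 2%:R) ?pnatr_eq0 //.
suff -> : 2%:R *: w = 0 by rewrite scaler0.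
have : (w + 1 *: (S *m w)) + (w + -1 *: (S *m w)) = 0 by rewrite w1 w2 addr0.
by rewrite scaleN1r scale1r addrACA subrr addr0 scaler_nat mulr2n.
Qed.

(** Induction on [Ss]: replacing [w] by an eigenvector [u] of the head [S] for a sign [s] leaves an
    eigenvector of the remaining sum for [E - s], and [s <= 1]. [E] is not assumed real; the base
    case [E = 0] and the real signs make it so. *)
Lemma sum_involutions_eigenvalue_le Ss (E : F) w :
    commuting_involutions Ss -> w != 0 ->
  (\sum_(S <- Ss) S) *m w = E *: w -> E <= (size Ss)%:R.
Proof.
elim: Ss E w => [|S Ss IH] E w [invS comS] w0.
  rewrite big_nil mul0mx => /esym/eqP; rewrite scaler_eq0 (negPf w0) orbF.
  by move=> /eqP ->.
have [inSs comSs] : commuting_involutions Ss.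
  split=> [T TSs|T U TSs USs]; first by apply: invS; rewrite in_cons TSs orbT.
  by apply: comS; rewrite in_cons ?TSs ?USs orbT.
have SS : S *m S = 1%:M by apply: invS; rewrite mem_head.
have [s s1 ws0] := involution_eigenvector SS w0.
rewrite big_cons; set M := \sum_(T <- Ss) T => Mw.
have SM : S *m M = M *m S.
  rewrite mulmx_sumr mulmx_suml; apply: eq_big_seq => T TSs.
  by apply: comS; rewrite ?mem_head // in_cons TSs orbT.
set u := w + s *: (S *m w) in ws0.
have Su : S *m u = s *: u.
  rewrite mulmxDr -scalemxAr mulmxA SS mul1mx scalerDr scalerA addrC.
  by congr (_ + _); case: s1 => ->; rewrite ?mulrNN mulr1 scale1r.
have Mu : M *m u = (E - s) *: u.
  (* [S + M] commutes with [S], so it maps [u] to [E u] just as it does [w]; subtracting [S u = s u]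
     leaves [E - s]. *)
  have -> : M = (S + M) - S by rewrite addrC addKr.
  rewrite mulmxBl Su scalerBl; congr (_ - _).
  rewrite mulmxDr -scalemxAr mulmxA.
  by rewrite [(S + M) *m S]mulmxDl -SM -mulmxDr -mulmxA Mw
    -scalemxAr scalerDr scalerA [s * E]mulrC -scalerA.
have := IH _ _ (conj inSs comSs) ws0 Mu.
rewrite lerBlDr => /le_trans; apply; rewrite /= -natr1 lerD2l.
by case: s1 => -> //; rewrite lerNl (le_trans _ ler01) // lerN10.
Qed.

End InvolutionSums.

(** * Algebra of iterated tensor products *)

Section Tensor.
Variable C : comPzRingType.

Lemma eq_tensor p q n (f g : 'I_n.+1 -> 'M[C]_(p, q)) :
  f =1 g -> tensor f = tensor g.
Proof.
by elim: n f g => [|n IH] f g fg /=; rewrite fg //; congr (_ *t _); apply: IH.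
Qed.

Lemma tensor_mul p q r n (f : 'I_n.+1 -> 'M[C]_(p, q))
    (g : 'I_n.+1 -> 'M[C]_(q, r)) :
  tensor f *m tensor g = tensor (fun i => f i *m g i).
Proof.
by elim: n f g => [|n IH] f g //; rewrite [LHS]tensmx_mul IH.
Qed.

(** Serves to gather the scalars arising qubit by qubit, such as signs, into one global factor. *)
Lemma tensorZ p q n (a : 'I_n.+1 -> C) (f : 'I_n.+1 -> 'M[C]_(p, q)) :
  tensor (fun i => a i *: f i) = (\prod_i a i) *: tensor f.
Proof.
elim: n a f => [|n IH] a f; first by rewrite big_ord1.
rewrite big_ord_recl /= (IH (fun i => a (lift ord0 i))).
by apply/matrixP => i j; rewrite !mxE mulrACA.
Qed.

Lemma tensor1 p n : tensor (fun _ : 'I_n.+1 => 1%:M : 'M[C]_p) = 1%:M.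
Proof.
elim: n => [|n IH] //=; rewrite IH.
apply/matrixP => i j.
case: (mxtens_indexP i) => i0 i1; case: (mxtens_indexP j) => j0 j1.
rewrite tensmxE !mxE (can_eq (@mxtens_indexK _ _)) xpair_eqE.
by rewrite -natrM mulnb.
Qed.

Lemma tr_tensor p q n (f : 'I_n.+1 -> 'M[C]_(p, q)) :
  (tensor f)^T = tensor (fun i => (f i)^T).
Proof. by elim: n f => [|n IH] f //; rewrite [LHS]trmx_tens IH. Qed.

End Tensor.

(* Locked, because unification would otherwise unfold the 128 x 128 tensors. *)
HB.lock Definition pauli (R : realType) (P : 'M[R[i]]_2) (s : seq nat) :
    'M[R[i]]_(2 ^ 7) :=
  tensor (fun i : 'I_7 => if i.+1 \in s then P else 1%:M).

(** * Pauli strings and their action on the computational basis *)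

Section Pauli.
Variable R : realType.
Local Notation C := R[i].
Implicit Types (P Q : 'M[C]_2) (s t : seq nat).

Lemma on_qubitE P k : on_qubit P k = pauli P [:: k].
Proof. by rewrite pauli.unlock; apply: eq_tensor => i; rewrite mem_seq1. Qed.

(** On each qubit at most one of the two factors is [P]. This merges the products defining [A1],
    ..., [B2] into single strings. *)
Lemma pauli_cat P s t : ~~ has (mem s) t ->
  pauli P s *m pauli P t = pauli P (s ++ t).
Proof.
move=> /hasPn st; rewrite !pauli.unlock [LHS](@tensor_mul _ 2 2 2 6); apply: eq_tensor => i; rewrite mem_cat.
have := st i.+1; case: ifP => [/= is_s|_]; case: ifP => //= it.
- by move=> /(_ isT); rewrite is_s.
- by rewrite mulmx1.
- by rewrite mul1mx.
- by rewrite mul1mx.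
Qed.

Lemma pauli_sqr P s : P *m P = 1%:M -> pauli P s *m pauli P s = 1%:M.
Proof.
move=> PP; rewrite !pauli.unlock [LHS](@tensor_mul _ 2 2 2 6) -[RHS](@tensor1 _ 2 6); apply: eq_tensor => i.
by case: ifP; rewrite ?mul1mx.
Qed.

Lemma pauli_comm P s t : pauli P s *m pauli P t = pauli P t *m pauli P s.
Proof.
rewrite !pauli.unlock [LHS](@tensor_mul _ 2 2 2 6) [RHS](@tensor_mul _ 2 2 2 6); apply: eq_tensor => i.
by do 2!case: ifP => _; rewrite ?mul1mx ?mulmx1.
Qed.

(** Each qubit common to [s] and [t] contributes a factor -1, and an even number of these cancel. *)
Lemma pauli_anticomm P Q s t : P *m Q = - (Q *m P) ->
    ~~ odd (\sum_(i < 7) ((i.+1 \in s) && (i.+1 \in t))) ->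
  pauli P s *m pauli Q t = pauli Q t *m pauli P s.
Proof.
move=> PQ ev.
rewrite !pauli.unlock [LHS](@tensor_mul _ 2 2 2 6) [RHS](@tensor_mul _ 2 2 2 6).
pose a (i : 'I_7) : C := (-1) ^+ ((i.+1 \in s) && (i.+1 \in t)).
have a1 : \prod_i a i = 1.
  by rewrite prodrXr -signr_odd (negPf ev).
rewrite -[RHS]scale1r -[X in X *: _]a1 -tensorZ; apply: eq_tensor => i; rewrite /a.
by do 2!case: ifP => _; rewrite /= ?expr0 ?expr1 ?scaleN1r ?scale1r ?mul1mx ?mulmx1.
Qed.

Lemma I2_cases (P : 'I_2 -> Prop) : P 0 -> P 1 -> forall i, P i.
Proof.
move=> P0 P1 [[|[|//]] lti].
- by rewrite (_ : Ordinal lti = 0) //; apply: val_inj.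
- by rewrite (_ : Ordinal lti = 1) //; apply: val_inj.
Qed.

Lemma sigma_z_sqr : sigma_z R *m sigma_z R = 1%:M.
Proof.
apply/matrixP => i j; rewrite !mxE !big_ord_recl big_ord0 !mxE.
by move: i j; do 2!apply: I2_cases; rewrite /= ?expr0 ?expr1; ring.
Qed.

Lemma sigma_x_sqr : sigma_x R *m sigma_x R = 1%:M.
Proof.
apply/matrixP => i j; rewrite !mxE !big_ord_recl big_ord0 !mxE.
by move: i j; do 2!apply: I2_cases; rewrite /=; ring.
Qed.

Lemma sigma_zx : sigma_z R *m sigma_x R = - (sigma_x R *m sigma_z R).
Proof.
apply/matrixP => i j; rewrite !mxE !big_ord_recl !big_ord0 !mxE.
by move: i j; do 2!apply: I2_cases; rewrite /= ?expr0 ?expr1; ring.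
Qed.

Lemma sigma_z_delta (b : 'I_2) :
  sigma_z R *m (delta_mx b 0 : 'cV_2) = (-1) ^+ b *: delta_mx b 0.
Proof.
apply/matrixP => i j; rewrite !mxE !big_ord_recl !big_ord0 !mxE.
by rewrite [j]ord1; move: i b; do 2!apply: I2_cases;
   rewrite /= ?expr0 ?expr1; ring.
Qed.

(** On ['I_2], [rev_ord] is the bit flip. *)
Lemma sigma_x_delta (b : 'I_2) :
  sigma_x R *m (delta_mx b 0 : 'cV_2) = delta_mx (rev_ord b) 0.
Proof.
apply/matrixP => i j; rewrite !mxE !big_ord_recl !big_ord0 !mxE.
by rewrite [j]ord1; move: i b; do 2!apply: I2_cases; rewrite /=; ring.
Qed.

(** [1 ^ 7] computes to [1] and equality proofs on [nat] are unique, so the cast is along [erefl]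
    and disappears. *)
Lemma ketE (b : 7.-tuple 'I_2) :
  ket R b = tensor (fun k : 'I_7 => delta_mx (tnth b k) 0 : 'cV[C]_2).
Proof. by rewrite /ket (eq_irrelevance (exp1n 7) (erefl 1%N)). Qed.

(** Inner products multiply over the qubits, and a single differing bit makes the product vanish. *)
Lemma ket_orthonormal (b c : 7.-tuple 'I_2) :
  (ket R b)^T *m ket R c = (b == c)%:R%:M.
Proof.
have -> : (ket R b)^T =
    tensor (fun i : 'I_7 => (delta_mx (tnth b i) 0 : 'cV[C]_2)^T).
  by rewrite ketE; exact: (@tr_tensor _ 2 1 6).
rewrite ketE [LHS](@tensor_mul _ 1 2 1 6).
pose a (i : 'I_7) : C := (tnth b i == tnth c i)%:R.
rewrite (eq_tensor (g := fun i => a i *: 1%:M)); last first.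
  move=> i; rewrite trmx_delta mul_delta_mx_cond /a scaler_nat; congr (_ *+ _).
  by apply/matrixP => j k; rewrite !ord1 !mxE.
rewrite (tensorZ a) tensor1 scalemx1; congr _%:M.
case: eqVneq => bc; first by apply: big1 => i _; rewrite /a bc eqxx.
have [i bci] : exists i, tnth b i != tnth c i.
  apply/existsP; apply: contraNT bc; rewrite negb_exists => /forallP bc.
  by apply/eqP/eq_from_tnth => i; apply/eqP; have := bc i; rewrite negbK.
by rewrite (bigD1 i) //= /a (negPf bci) mul0r.
Qed.

(** Each qubit of [s] whose bit is 1 contributes a sign -1; the hypothesis says that their number is
    even. *)
Lemma pauli_z_ket s (b : 7.-tuple 'I_2) :
    ~~ odd (\sum_(i < 7) ((i.+1 \in s) * tnth b i)%N) ->
  pauli (sigma_z R) s *m ket R b = ket R b.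
Proof.
move=> ev; rewrite pauli.unlock !ketE [LHS](@tensor_mul _ 2 2 1 6).
pose a (i : 'I_7) : C := (-1) ^+ ((i.+1 \in s) * tnth b i)%N.
have a1 : \prod_i a i = 1.
  by rewrite prodrXr -signr_odd (negPf ev).
rewrite -[RHS]scale1r -[X in X *: _]a1 -[RHS](@tensorZ _ 2 1 6); apply: (@eq_tensor _ 2 1 6) => i; rewrite /a.
by case: ifP => _; rewrite ?mul1n ?sigma_z_delta // mul0n scale1r mul1mx.
Qed.

Lemma pauli_x_ket s (b c : 7.-tuple 'I_2) :
    (forall i, tnth c i = if i.+1 \in s then rev_ord (tnth b i) else tnth b i) ->
  pauli (sigma_x R) s *m ket R b = ket R c.
Proof.
move=> bc; rewrite pauli.unlock !ketE [LHS](@tensor_mul _ 2 2 1 6); apply: (@eq_tensor _ 2 1 6) => i.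
by rewrite bc; case: ifP => _; rewrite ?sigma_x_delta ?mul1mx.
Qed.

End Pauli.

(** * The stabilizers of the toric code and its ground state *)

Section GroundState.
Variable R : realType.
Local Notation C := R[i].

Definition z_supports : seq (seq nat) :=
  [:: [:: 1; 2]; [:: 1; 3]; [:: 2; 4; 5]; [:: 3; 4; 6]; [:: 5; 7]; [:: 6; 7]]%N.

Definition x_supports : seq (seq nat) :=
  [:: [:: 1; 2; 3; 4]; [:: 4; 5; 6; 7]]%N.

Definition stabilizers : seq 'M[C]_(2 ^ 7) :=
  [seq pauli (sigma_z R) s | s <- z_supports]
  ++ [seq pauli (sigma_x R) s | s <- x_supports].

Lemma H7tdE : H7td R = - \sum_(S <- stabilizers) S.
Proof.
(* The rearrangement is done in an arbitrary abelian group, where the eight terms are mere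
   variables. *)
have sum8 (V : zmodType) (a b c d e f g h : V) :
    - (a + b + c + d + e + f) - (g + h)
    = - \sum_(x <- [:: a; b; c; d; e; f; g; h]) x.
  by rewrite !big_cons big_nil addr0 -opprD !addrA.
rewrite /H7td /A1 /A2 /A3 /A4 /A5 /A6 /B1 /B2 /Z /X !on_qubitE.
rewrite !pauli_cat //; exact: sum8.
Qed.

Lemma stabilizers_commuting_involutions : commuting_involutions stabilizers.
Proof.
have zx s t : s \in z_supports -> t \in x_supports ->
    pauli (sigma_z R) s *m pauli (sigma_x R) t =
    pauli (sigma_x R) t *m pauli (sigma_z R) s.
  move=> sz tx; apply: pauli_anticomm; first exact: sigma_zx.
  (* Every Z-support meets every X-support in 0 or 2 qubits; the twelve pairs are checked by
     computation. *)
  by rewrite !big_ord_recl big_ord0; move: t tx; apply/allP; move: s sz; apply/allP.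
split=> [S|S T]; rewrite mem_cat.
  case/orP=> /mapP[s _ ->]; apply: pauli_sqr.
    exact: sigma_z_sqr.
  exact: sigma_x_sqr.
rewrite mem_cat; case/orP=> /mapP[s s_in ->]; case/orP=> /mapP[t t_in ->].
- exact: pauli_comm.
- exact: zx.
- by rewrite zx.
- exact: pauli_comm.
Qed.

(* The images of the four kets are kept as hypotheses: rewriting with them
   would make Rocq compare distinct kets by unfolding their tensors. *)
Lemma mulmx_psi7 m (M : 'M[C]_(m, 2 ^ 7)) (u1 u2 u3 u4 : 'cV[C]_m)
    (a1 a2 a3 a4 : R) :
    M *m ket R [tuple 0; 0; 0; 0; 0; 0; 0] = u1 ->
    M *m ket R [tuple 0; 0; 0; 1; 1; 1; 1] = u2 ->
    M *m ket R [tuple 1; 1; 1; 1; 0; 0; 0] = u3 ->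
    M *m ket R [tuple 1; 1; 1; 0; 1; 1; 1] = u4 ->
  M *m psi7 a1 a2 a3 a4 =
    a1%:C%C *: u1 + a2%:C%C *: u2 + a3%:C%C *: u3 + a4%:C%C *: u4.
Proof.
rewrite /psi7; do 4![move: (ket R _) => ?].
by move=> <- <- <- <-; rewrite !mulmxDr -!scalemxAr.
Qed.

(** By orthonormality, pairing the state with the all-zero ket extracts [a1]. *)
Lemma psi7_neq0 (a1 a2 a3 a4 : R) : a1 != 0 -> psi7 a1 a2 a3 a4 != 0.
Proof.
apply: contra_neq => psi0.
have := mulmx_psi7 a1 a2 a3 a4
  (ket_orthonormal R [tuple 0; 0; 0; 0; 0; 0; 0] _) (ket_orthonormal R _ _)
  (ket_orthonormal R _ _) (ket_orthonormal R _ _).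
rewrite psi0 mulmx0 => /matrixP/(_ 0 0).
rewrite !mxE /= !mulr0 !addr0 mulr1.
by move/esym/eqP; rewrite fmorph_eq0 => /eqP.
Qed.

Ltac flip_bits :=
  case=> [[|[|[|[|[|[|[|//]]]]]]] ?]; rewrite !(tnth_nth 0); apply: val_inj.

Lemma stabilizer_psi7 (a : R) S :
  S \in stabilizers -> S *m psi7 a a a a = psi7 a a a a.
Proof.
rewrite mem_cat => /orP[] /mapP[s s_in ->].
  (* Each of the four bit strings has an even number of ones on every Z-support. *)
  by apply: mulmx_psi7; apply: pauli_z_ket;
     rewrite !big_ord_recl big_ord0 !(tnth_nth 0); move: s s_in; apply/allP.
move: s_in; rewrite !inE => /orP[] /eqP ->.
(* Flipping qubits 1 to 4 exchanges the first ket with the third and the second with the fourth;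
   equal coefficients absorb this. *)
- rewrite (mulmx_psi7 _ _ _ _ (u1 := ket R [tuple 1; 1; 1; 1; 0; 0; 0])
    (u2 := ket R [tuple 1; 1; 1; 0; 1; 1; 1])
    (u3 := ket R [tuple 0; 0; 0; 0; 0; 0; 0])
    (u4 := ket R [tuple 0; 0; 0; 1; 1; 1; 1])); try by apply: pauli_x_ket; flip_bits.
  rewrite /psi7; do 4![move: (ket R _) => ?].
  by rewrite -addrA addrC addrA.
(* Flipping qubits 4 to 7 exchanges the first ket with the second and the third with the fourth. *)
- rewrite (mulmx_psi7 _ _ _ _ (u1 := ket R [tuple 0; 0; 0; 1; 1; 1; 1])
    (u2 := ket R [tuple 0; 0; 0; 0; 0; 0; 0])
    (u3 := ket R [tuple 1; 1; 1; 0; 1; 1; 1])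
    (u4 := ket R [tuple 1; 1; 1; 1; 0; 0; 0])); try by apply: pauli_x_ket; flip_bits.
  rewrite /psi7; do 4![move: (ket R _) => ?].
  by rewrite [X in X + _ + _]addrC -addrA [X in _ + X]addrC addrA.
Qed.

Lemma ground_state_psi7 (a : R) :
  a != 0 -> ground_state (H7td R) (psi7 a a a a).
Proof.
(* The sum of the stabilizers is [- H7td], so the upper bound on its eigenvalues becomes a lower
   bound on the energies. *)
move=> a0; have HE (E : C) (w : 'cV_(2 ^ 7)) : H7td R *m w = E *: w ->
    (\sum_(S <- stabilizers) S) *m w = (- E) *: w.
  by rewrite H7tdE mulNmx scaleNr => <-; rewrite opprK.
exists (- 8%:R); last first.
  move=> E w [w0 Hw]; rewrite lerNl.
  have := sum_involutions_eigenvalue_le stabilizers_commuting_involutions w0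
    (HE _ _ Hw).
  by rewrite size_cat !size_map.
split; first exact: psi7_neq0.
rewrite H7tdE mulNmx mulmx_suml (eq_big_seq _ (@stabilizer_psi7 a)).
by rewrite big_const_seq count_predT iter_addr_0 scaleNr scaler_nat.
Qed.

End GroundState.

Theorem mainTheorem2 (R : realType) :
  exists a1 a2 a3 a4 : R,
    [/\ a1 ^+ 2 = 1 / 4, a2 ^+ 2 = 1 / 4, a3 ^+ 2 = 1 / 4 & a4 ^+ 2 = 1 / 4] /\
    ground_state (H7td R) (psi7 a1 a2 a3 a4).
Proof.
exists (1 / 2), (1 / 2), (1 / 2), (1 / 2); split.
  by split; field.
by apply: ground_state_psi7; rewrite mulf_neq0 ?invr_eq0 ?oner_eq0 ?pnatr_eq0.
Qed.
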